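(* Let $X$ be a type space $S_n(A)$ or a definable subset of a type space. The following are equivalent: (i) $X$ is dictionaric. (ii) For every $\varepsilon>0$, $X$ has a basis of open sets $U$ satisfying $\operatorname{cl} U\subseteq U^{<\varepsilon}$. (iii) Definable sets separate disjoint closed subsets of $X$, i.e. for all disjoint closed $F,G\subseteq X$ there are disjoint definable sets $D,E\subseteq X$ with $F\subseteq D$ and $G\subseteq E$. (iv) For all closed $F,G\subseteq X$ with $F\cap G=\varnothing$, there is a definable set $D\subseteq X$ such that either $F\subseteq D$ and $D\cap G=\varnothing$, or $G\subseteq D$ and $D\cap F=\varnothing$. (v) $X$ has a network of definable sets, i.e. for every $p\in U\subseteq X$ with $U$ open in $X$, there is a definable set $D$ such that $p\in D\subseteq U$. (vi) For every $p\in U\subseteq X$ with $U$ open in $X$, and every $\varepsilon>0$, there is an open set $V\subseteq U$ and a closed set $F\subseteq X$ such that $p\in V$ and $d_H(V,F)<\varepsilon$.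
   Context: Setting: continuous first-order logic for metric structures. $S_n(A)$ is the space of complete $n$-types over a parameter set $A$, a compact Hausdorff space under the logic topology, also equipped with the metric $d(p,q)=\inf\{d(\bar a,\bar b):\bar a\models p,\ \bar b\models q\}$ computed in a monster model. ''Open'', ''closed'', ''interior'' and $\operatorname{cl}$ (closure) refer to the logic topology. For $Q\subseteq S_n(A)$, $Q^{<\varepsilon}=\{q:d(q,Q)<\varepsilon\}$. $d_H(A,B)=\max\{\sup_{a\in A}d(a,B),\sup_{b\in B}d(b,A)\}$ is the Hausdorff (pseudo-)distance. A closed set $D\subseteq S_n(A)$ is definable if for every $\varepsilon>0$ there is an open $U$ with $D\subseteq U\subseteq D^{<\varepsilon}$. $X$ is dictionaric if for every $p\in X$ and closed $F\subseteq X$ with $p\notin F$, there is a definable set $D\subseteq X$ such that $p\in\operatorname{int}_X D$ (interior relative to $X$) and $D\cap F=\varnothing$. *)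

(* Defs.v *)
From HB Require Import structures.
From mathcomp Require Import all_boot all_order all_algebra.
From mathcomp Require Import all_classical all_reals all_analysis.
Import Order.TTheory GRing.Theory Num.Theory.
Import numFieldNormedType.Exports.

Set Implicit Arguments.
Unset Strict Implicit.
Unset Printing Implicit Defensive.

Local Open Scope classical_set_scope.
Local Open Scope card_scope.
Local Open Scope ring_scope.

Record signature (R : realType) := Signature {
  diam : R;
  fsym : Type;
  fsym_arity : fsym -> nat;
  fsym_modulus : fsym -> R -> R;
  fsym_modulus_gt0 : forall f e, 0 < e -> 0 < fsym_modulus f e;
  psym : Type;
  psym_arity : psym -> nat;
  psym_modulus : psym -> R -> R;
  psym_modulus_gt0 : forall P e, 0 < e -> 0 < psym_modulus P e;
  psym_lower : psym -> R;
  psym_upper : psym -> R }.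

Definition tuple_dist (R : realType) (M : metricType R) (n : nat)
    (a b : 'I_n -> M) : R :=
  \big[Num.max/0]_(i < n) mdist (a i) (b i).

Record structure (R : realType) (L : signature R) := Structure {
  carrier :> metricType R;
  carrier_inh : inhabited carrier;
  carrier_complete : forall F : set_system carrier,
    ProperFilter F -> cauchy F -> exists x : carrier, F --> x;
  carrier_bounded : forall x y : carrier, mdist x y <= diam L;
  fint : forall f : fsym L, ('I_(fsym_arity f) -> carrier) -> carrier;
  fint_unif : forall (f : fsym L) e (a b : 'I_(fsym_arity f) -> carrier), 0 < e ->
    tuple_dist a b < fsym_modulus f e -> mdist (fint a) (fint b) <= e;
  pint : forall P : psym L, ('I_(psym_arity P) -> carrier) -> R;
  pint_range : forall (P : psym L) (a : 'I_(psym_arity P) -> carrier),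
    psym_lower P <= pint a <= psym_upper P;
  pint_unif : forall (P : psym L) e (a b : 'I_(psym_arity P) -> carrier), 0 < e ->
    tuple_dist a b < psym_modulus P e -> `|pint a - pint b| <= e }.

Arguments fint {R L} s f a : rename.
Arguments pint {R L} s P a : rename.

(* Terms and formulas in the free variables x_0, ..., x_(k-1) with parameters
   named by the elements of C.  Quantifiers bind the variable of index 0 and
   shift the others (de Bruijn).  Connectives are all continuous functions
   R^m -> R, including the constants (m = 0). *)
Inductive term (R : realType) (L : signature R) (C : Type) (k : nat) : Type :=
| tVar of 'I_k
| tPar of C
| tApp (f : fsym L) of ('I_(fsym_arity f) -> term L C k).

Inductive formula (R : realType) (L : signature R) (C : Type) : nat -> Type :=
| fDist k of term L C k & term L C k : formula L C k
| fPred k (P : psym L) of ('I_(psym_arity P) -> term L C k) : formula L C k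
| fConn k m (u : 'rV[R]_m -> R) of continuous u & ('I_m -> formula L C k) :
    formula L C k
| fInf k of formula L C k.+1 : formula L C k
| fSup k of formula L C k.+1 : formula L C k.

Definition env_cons (T : Type) (k : nat) (x : T) (e : 'I_k -> T) :
    'I_k.+1 -> T :=
  fun i => oapp e x (unlift ord0 i).

Fixpoint teval (R : realType) (L : signature R) (M : structure L) (C : Type)
    (c : C -> M) (k : nat) (e : 'I_k -> M) (t : term L C k) : M :=
  match t with
  | tVar i => e i
  | tPar a => c a
  | tApp f ts => fint M f (fun i => teval c e (ts i))
  end.

Fixpoint feval (R : realType) (L : signature R) (M : structure L) (C : Type)
    (c : C -> M) (k : nat) (p : formula L C k) : ('I_k -> M) -> R :=
  match p in formula _ _ k return ('I_k -> M) -> R with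
  | fDist _ t1 t2 => fun e => mdist (teval c e t1) (teval c e t2)
  | fPred _ P ts => fun e => pint M P (fun i => teval c e (ts i))
  | fConn _ _ u _ ps => fun e => u (\row_i feval c (ps i) e)
  | fInf _ q => fun e => inf (range (fun x : M => feval c q (env_cons x e)))
  | fSup _ q => fun e => sup (range (fun x : M => feval c q (env_cons x e)))
  end.

(* L(A)-formulas, evaluated with every parameter denoting itself. *)
Definition formula_over (R : realType) (L : signature R) (M : structure L)
    (A : set M) (n : nat) : Type :=
  formula L A n.

Definition eval_over (R : realType) (L : signature R) (M : structure L)
    (A : set M) (n : nat) (p : formula_over A n) (a : 'I_n -> M) : R :=
  feval (set_val : A -> M) p a.

(* A complete n-type over A is identified with the function sending each
   L(A)-formula to the value it prescribes; consistency with the elementary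
   diagram of M over A is approximate finite satisfiability in M. *)
Definition is_complete_type (R : realType) (L : signature R) (M : structure L)
    (A : set M) (n : nat) (p : formula_over A n -> R) : Prop :=
  forall (m : nat) (q : 'I_m -> formula_over A n) (e : R), 0 < e ->
    exists a : 'I_n -> M, forall i, `|eval_over (q i) a - p (q i)| < e.

(* S_n(A).  The logic topology is the coarsest one making p |-> p(q)
   continuous for each formula q, that is, pointwise convergence. *)
Definition type_space (R : realType) (L : signature R) (M : structure L)
    (A : set M) (n : nat) : topologicalType :=
  set_type [set p : {ptws formula_over A n -> R} | is_complete_type p].

Definition realizes (R : realType) (L : signature R) (M : structure L)
    (A : set M) (n : nat) (a : 'I_n -> M) (p : type_space A n) : Prop :=
  forall q : formula_over A n, eval_over q a = set_val p q.

(* |A| < |K|, the cardinal being represented by the type K *)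
Definition small (K T : Type) (A : set T) : Prop := ~~ ([set: K] #<= A).

Definition saturated (R : realType) (L : signature R) (K : Type)
    (M : structure L) : Prop :=
  forall (A : set M) (n : nat), small K A ->
    forall p : type_space A n, exists a : 'I_n -> M, realizes a p.

Definition elementary_on (R : realType) (L : signature R) (M : structure L)
    (A : set M) (h : M -> M) : Prop :=
  forall (q : formula L A 0) (e : 'I_0 -> M),
    feval (fun a : A => h (set_val a)) q e = feval (set_val : A -> M) q e.

Definition automorphism (R : realType) (L : signature R) (M : structure L)
    (s : M -> M) : Prop :=
  [/\ bijective s,
      forall x y, mdist (s x) (s y) = mdist x y,
      forall (f : fsym L) a, s (fint M f a) = fint M f (s \o a)
    & forall (P : psym L) a, pint M P (s \o a) = pint M P a].

Definition strongly_homogeneous (R : realType) (L : signature R) (K : Type)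
    (M : structure L) : Prop :=
  forall (A : set M) (h : M -> M), small K A -> elementary_on A h ->
    exists2 s : M -> M, automorphism s & {in A, s =1 h}.

Definition monster (R : realType) (L : signature R) (K : Type)
    (M : structure L) : Prop :=
  [/\ infinite_set [set: K], saturated K M & strongly_homogeneous K M].

Definition type_dist (R : realType) (L : signature R) (M : structure L)
    (A : set M) (n : nat) (p q : type_space A n) : R :=
  inf [set tuple_dist a b | a in [set a | realizes a p] &
                            b in [set b | realizes b q]].

(* Distances to a set and Hausdorff distances take values in [-oo, +oo] so that
   nothing is at finite distance from the empty set. *)
Definition dist_to (R : realType) (L : signature R) (M : structure L)
    (A : set M) (n : nat) (p : type_space A n) (Q : set (type_space A n)) :
    \bar R :=
  ereal_inf [set (type_dist p q)%:E | q in Q].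

Definition fattening (R : realType) (L : signature R) (M : structure L)
    (A : set M) (n : nat) (e : R) (Q : set (type_space A n)) :
    set (type_space A n) :=
  [set p | (dist_to p Q < e%:E)%E].

Definition hausdorff_dist (R : realType) (L : signature R) (M : structure L)
    (A : set M) (n : nat) (P Q : set (type_space A n)) : \bar R :=
  Order.max (ereal_sup [set dist_to p Q | p in P])
            (ereal_sup [set dist_to q P | q in Q]).

Definition definable (R : realType) (L : signature R) (M : structure L)
    (A : set M) (n : nat) (D : set (type_space A n)) : Prop :=
  closed D /\
  forall e : R, 0 < e ->
    exists U : set (type_space A n), [/\ open U, D `<=` U & U `<=` fattening e D].

Definition open_in (T : topologicalType) (X U : set T) : Prop :=
  exists2 O : set T, open O & U = O `&` X.

Definition interior_in (T : topologicalType) (X D : set T) : set T :=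
  [set p | exists U : set T, [/\ open_in X U, U p & U `<=` D]].

Definition basis_in (T : topologicalType) (X : set T) (B : set (set T)) : Prop :=
  (forall U, B U -> open_in X U) /\
  forall p W, open_in X W -> W p -> exists U, [/\ B U, U p & U `<=` W].

Definition dictionaric (R : realType) (L : signature R) (M : structure L)
    (A : set M) (n : nat) (X : set (type_space A n)) : Prop :=
  forall (p : type_space A n) (F : set (type_space A n)),
    X p -> closed F -> F `<=` X -> ~ F p ->
    exists D : set (type_space A n),
      [/\ definable D, D `<=` X, interior_in X D p & D `&` F = set0].

(* Main.v *)
(* Only four properties of S_n(A) matter: it is compact Hausdorff, d is a metric,
   d is lower semicontinuous, and U^{<e} is open when U is. All come from
   saturation and the compactness of S_n(A) and S_2n(A): d(p, q) is attained by
   a realization of a 2n-type, U^{<e} is open by means of the formulas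
   inf_y max(d(x, y) - e, phi(y)), and openness together with lower
   semicontinuity gives the triangle inequality without homogeneity.

   (i) => (v) and (iii) => (iv) => (v) are direct; (v) => (ii) takes an
   open neighbourhood of D inside D^{<e}, and (ii) => (vi) takes the closure of
   V for F. Finally (vi) implies that definable sets interpolate between closed
   and open sets, whence (i) and (iii). *)
Require Import Defs.
From mathcomp Require Import all_boot all_order all_algebra.
From mathcomp Require Import all_classical all_reals all_analysis.
From mathcomp Require Import lra.
Import Order.TTheory GRing.Theory Num.Theory.
Import numFieldNormedType.Exports.

Set Implicit Arguments.
Unset Strict Implicit.
Unset Printing Implicit Defensive.

Local Open Scope classical_set_scope.
Local Open Scope ring_scope.

(** * Compact topometric spaces *)

(** If it failed, the sets whose complement in [K] satisfies [Q] would form a proper filter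
    containing [K], and a cluster point would contradict the local hypothesis. This replaces the
    choice of a finite subcover. *)
Lemma compact_ind (T : topologicalType) (K : set T) (Q : set T -> Prop) :
  compact K -> Q set0 -> (forall S S', S `<=` S' -> Q S' -> Q S) ->
  (forall S S', Q S -> Q S' -> Q (S `|` S')) ->
  (forall x, K x -> exists2 U, nbhs x U & Q U) -> Q K.
Proof.
move=> cK Q0 Qsub QU Qloc; apply: contrapT => nQK.
pose F := [set S | Q (K `\` S)].
have FF : ProperFilter F.
  split; first by rewrite /F/= setD0.
  split=> [|S S' QS QS'|S S' SS']; rewrite /F/= ?setDT//.
    by rewrite setDIr; exact: QU.
  by apply: Qsub; exact: setDS.
have FK : F K by rewrite /F/= setDv.
have [x [Kx clFx]] := cK F FF FK.
have [U xU QU'] := Qloc x Kx.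
have FU : F (~` U) by rewrite /F/= setDE setCK; apply: Qsub QU'; exact: subIsetr.
by have [y []] := clFx _ _ FU xU.
Qed.

Lemma compact_bigcap_directed (T : topologicalType) (I : Type) (D : set I)
    (C : I -> set T) :
  compact [set: T] -> D !=set0 -> (forall i, D i -> closed (C i)) ->
  (forall i, D i -> C i !=set0) ->
  (forall i j, D i -> D j -> exists2 k, D k & C k `<=` C i `&` C j) ->
  (\bigcap_(i in D) C i) !=set0.
Proof.
move=> cT [i0 Di0] clC C0 CI.
have FF : Filter (filter_from D C) by apply: filter_from_filter => //; exists i0.
have PF : ProperFilter (filter_from D C) by apply: filter_from_proper.
have [x [_ clx]] := cT _ PF filterT.
exists x => i Di; apply: clC => // B xB.
by apply: clx => //; exists i.
Qed.

Section Thicken.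
Context (R : realType) (T : Type) (d : T -> T -> R).

(** A strict bound on an infimum has a witness, so for [type_dist] this is [fattening] freed of
    extended reals; see [fatteningE]. *)
Definition thicken (e : R) (Q : set T) : set T :=
  [set p | exists2 q, Q q & d p q < e].

Lemma thickenS e e' P Q : e <= e' -> P `<=` Q -> thicken e P `<=` thicken e' Q.
Proof. by move=> ee' PQ p [q /PQ Qq pq]; exists q => //; exact: lt_le_trans ee'. Qed.

Lemma thickenU e P Q : thicken e (P `|` Q) = thicken e P `|` thicken e Q.
Proof.
rewrite eqEsubset; split=> [p [q [Pq|Qq] pq]|p [] [q ? ?]].
- by left; exists q.
- by right; exists q.
- by exists q => //; left.
- by exists q => //; right.
Qed.

End Thicken.

(** A compact topometric space with an open metric. Lower semicontinuity appears as closedness of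
    the sublevel sets in the product. That the metric refines the topology then follows by
    compactness, see [closed_thicken_sub]. *)
Record topometric (R : realType) (T : topologicalType) (d : T -> T -> R) : Prop :=
  Topometric {
  topometric_compact : compact [set: T];
  topometric_hausdorff : hausdorff_space T;
  topometricxx : forall p, d p p = 0;
  topometric_sym : forall p q, d p q = d q p;
  topometric_triangle : forall p q r, d p r <= d p q + d q r;
  topometric_eq : forall p q, d p q = 0 -> p = q;
  topometric_lsc : forall e, closed [set pq : T * T | d pq.1 pq.2 <= e];
  topometric_open_thicken : forall e U, open U -> open (thicken d e U) }.

Definition metric_definable (R : realType) (T : topologicalType) (d : T -> T -> R)
    (D : set T) : Prop :=
  closed D /\ forall e, 0 < e ->
    exists U, [/\ open U, D `<=` U & U `<=` thicken d e D].

Section Topometric.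
Context (R : realType) (T : topologicalType) (d : T -> T -> R).
Context (dT : topometric d).

Let dxx := topometricxx dT.
Let dC := topometric_sym dT.
Let d_triangle := topometric_triangle dT.

Lemma topometric_ge0 p q : 0 <= d p q.
Proof. have := d_triangle p q p; rewrite dxx (dC q p); lra. Qed.

Lemma sub_thicken e Q : 0 < e -> Q `<=` thicken d e Q.
Proof. by move=> e0 q Qq; exists q => //; rewrite dxx. Qed.

Lemma thicken_thicken e e' Q : thicken d e (thicken d e' Q) `<=` thicken d (e + e') Q.
Proof.
move=> p [q [r Qr qr] pq]; exists r => //.
by have := d_triangle p q r; lra.
Qed.

(** The set is the first projection of a closed, hence compact, subset of the square. *)
Lemma closed_le_thicken e N : closed N ->
  closed [set p | exists2 q, N q & d p q <= e].
Proof.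
move=> clN.
have -> : [set p | exists2 q, N q & d p q <= e] =
    fst @` ([set pq : T * T | d pq.1 pq.2 <= e] `&` snd @^-1` N).
  rewrite eqEsubset; split=> [p [q Nq pq]|_ [[p q] [/= pq Nq] <-]].
    by exists (p, q).
  by exists q.
apply: (compact_closed (topometric_hausdorff dT)).
apply: continuous_compact; first by apply: continuous_subspaceT => ?; exact: cvg_fst.
apply: (subclosed_compact _ (B := setT `*` setT)) => //.
  apply: closedI; first exact: (topometric_lsc dT).
  by apply: preimage_closed => // x _; exact: cvg_snd.
by apply: compact_setX; exact: (topometric_compact dT).
Qed.

Lemma closure_thicken e N : closed N ->
  closure (thicken d e N) `<=` [set p | exists2 q, N q & d p q <= e].
Proof.
move=> clN; rewrite closureE => p; apply; split; first exact: closed_le_thicken.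
by move=> r [q Nq rq]; exists q => //; exact: ltW.
Qed.

Lemma closed_point (p : T) : closed [set p].
Proof.
exact/accessible_closed_set1/hausdorff_accessible/(topometric_hausdorff dT).
Qed.

(** Compactness is used twice. If no [e] works, some [p] outside [B] lies within every [e] of [N].
    The sets of points of [N] within [e] of [p] then have a common element, which is [p] itself by
    [topometric_eq]. *)
Lemma closed_thicken_sub N B : closed N -> open B -> N `<=` B ->
  exists2 e, 0 < e & thicken d e N `<=` B.
Proof.
move=> clN oB NB; apply: contrapT => noe.
pose C (e : R) := [set p | exists2 q, N q & d p q <= e] `&` ~` B.
have [|||e e' e0 e'0|p pC] :=
    @compact_bigcap_directed T R [set e | 0 < e] C (topometric_compact dT).
- by exists 1 => /=.
- by move=> e e0; apply: closedI; [exact: closed_le_thicken|exact: open_closedC].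
- move=> e e0; apply/set0P/eqP => C0; apply: noe; exists e => // p [q Nq pq].
  apply: contrapT => nBp; have : C e p by split=> //; exists q => //; exact: ltW.
  by rewrite C0.
- exists (Num.min e e'); first by rewrite /= lt_min e0.
  by move=> p [[q Nq +] nBp]; rewrite le_min => /andP[? ?]; do !split=> //; exists q.
have [_ nBp] : C 1 p by apply: pC => /=.
apply/nBp/NB.
have [|||e e' e0 e'0|q qC] := @compact_bigcap_directed T R [set e | 0 < e]
    (fun e => N `&` [set q | exists2 r, [set p] r & d q r <= e])
    (topometric_compact dT).
- by exists 1 => /=.
- by move=> e e0; apply: closedI => //; apply/closed_le_thicken/closed_point.
- move=> e /pC [[q Nq pq] _]; exists q; split=> //; exists p => //.
  by rewrite dC.
- exists (Num.min e e'); first by rewrite /= lt_min e0.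
  by move=> q [Nq [r rp]]; rewrite le_min => /andP[? ?]; do !split=> //; exists r.
have [Nq _] : (N `&` [set q | exists2 r, [set p] r & d q r <= 1]) q by apply: qC => /=.
suff -> : p = q by [].
apply: esym; apply: (topometric_eq dT); apply/eqP; rewrite eq_le topometric_ge0 andbT.
by apply/ler_addgt0Pr => e /qC[_ [r -> ]]; rewrite add0r.
Qed.

Lemma closed_open_between (F B : set T) : closed F -> open B -> F `<=` B ->
  exists V, [/\ open V, F `<=` V & closure V `<=` B].
Proof.
move=> clF oB FB.
have nT := compact_normal (topometric_hausdorff dT) (topometric_compact dT).
have [|S /set_nbhsP[V [oV FV VS]] clSO] := nT F clF B.
  by apply/set_nbhsP; exists B; split.
by exists V; split=> //; apply: subset_trans clSO; exact: closureS.
Qed.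

Lemma open_near (e : R) U : open U -> 0 < e -> forall p, U p ->
  exists e' U', [/\ 0 < e' <= e, open U', U' p & thicken d e' U' `<=` U].
Proof.
move=> oU e0 p Up.
have [|V [oV pV VU]] := closed_open_between (@closed_point p) oU; first by move=> _ ->.
have [e' e'0 e'U] := closed_thicken_sub (@closed_closure _ V) oU VU.
exists (Num.min e e'), V; split=> //.
- by rewrite lt_min e0 e'0 ge_min lexx.
- exact: pV.
apply: subset_trans e'U; apply: thickenS; last exact: subset_closure.
by rewrite ge_min lexx orbT.
Qed.

(** Brings the case of a full type space under that of a definable [X]. *)
Lemma metric_definableT : metric_definable d setT.
Proof.
split=> [|e e0]; first exact: closedT.
by exists setT; split=> //; [exact: openT|exact: sub_thicken].
Qed.

(** * Definable sets inside a definable subspace *)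

Section DefinableSubspace.
Context (X : set T) (defX : metric_definable d X).

Let clX : closed X := proj1 defX.

Lemma open_inU U V : open_in X U -> open_in X V -> open_in X (U `|` V).
Proof.
move=> [B oB ->] [B' oB' ->]; exists (B `|` B'); first exact: openU.
by rewrite setIUl.
Qed.

Lemma open_in_sub U : open_in X U -> U `<=` X.
Proof. by move=> [B _ ->] p []. Qed.

Lemma open_in0 : open_in X set0.
Proof. by exists set0; rewrite ?set0I//; exact: open0. Qed.

Lemma open_inT : open_in X X.
Proof. by exists setT; rewrite ?setTI//; exact: openT. Qed.

Lemma open_inDclosed F : closed F -> open_in X (X `\` F).
Proof. by move=> clF; exists (~` F); [exact: closed_openC|rewrite setDE setIC]. Qed.

Lemma closedD_open_in F U : closed F -> F `<=` X -> open_in X U -> closed (F `\` U).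
Proof.
move=> clF FX [B oB ->]; have -> : F `\` (B `&` X) = F `&` ~` B.
  rewrite eqEsubset; split=> [p [Fp nBX]|p [Fp nB]]; split=> //.
    by move=> Bp; apply: nBX; split=> //; exact: FX.
  by case.
by apply: closedI => //; exact: open_closedC.
Qed.

Lemma closure_open_in U : open_in X U -> closure U `<=` X.
Proof. by move=> /open_in_sub/closureS; rewrite -(iffLR (closure_id _) clX). Qed.

Lemma open_in_between F U : closed F -> open_in X U -> F `<=` U ->
  exists V, [/\ open_in X V, F `<=` V & closure V `<=` U].
Proof.
move=> clF oU FU; have FX := subset_trans FU (open_in_sub oU).
case: oU FU => B oB -> FU.
have [|V [oV FV VB]] := closed_open_between clF oB; first by move=> p /FU[].
exists (V `&` X); split; first by exists V.
  by move=> p Fp; split; [exact: FV|exact: FX].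
move=> p pV; split; first by apply: VB; apply: closureS pV; exact: subIsetl.
by apply: closure_open_in pV; exists V.
Qed.

(* A point of X near a point of a small open set B' lies in the slightly larger
   B, so up to an arbitrarily small error B `&` X can be replaced with the
   intersection of B' and an open neighbourhood of X. *)
Lemma open_thicken_open_in e U : open_in X U -> open (thicken d e U).
Proof.
move=> [B oB ->]; rewrite openE => p [q [Bq Xq] pq].
(* With [e'] at most half of the slack, [p] stays within [e - e'] of [q], and a further move of
   length less than [e'] still ends within [e]. *)
have [|e' [B' [/andP[e'0 e'l] oB' B'q B'B]]] :=
  @open_near ((e - d p q) / 2) _ oB _ _ Bq; first lra.
have [_ /(_ _ e'0)[W [oW XW WX]]] := defX.
have oBW : open (thicken d (e - e') (B' `&` W)).
  by apply: topometric_open_thicken => //; exact: openI.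
rewrite /interior nbhsE; exists (thicken d (e - e') (B' `&` W)).
  split=> //; exists q; last by lra.
  by split=> //; exact: XW.
move=> r [s [Bs' /WX[t Xt st]] rs]; exists t; last by have := d_triangle r s t; lra.
by split=> //; apply: B'B; exists s => //; rewrite dC.
Qed.

(** Thickening a relatively open set by [e / 2] makes it open in the whole space, since [X] is
    definable; the other half of [e] pays for the distance to [D]. *)
Lemma metric_definable_in D : closed D ->
  (forall e, 0 < e -> exists U, [/\ open_in X U, D `<=` U & U `<=` thicken d e D]) ->
  metric_definable d D.
Proof.
move=> clD hD; split=> // e e0; have e20 : 0 < e / 2 by lra.
have [U [oU DU UD]] := hD _ e20.
exists (thicken d (e / 2) U); split; first exact: open_thicken_open_in.
  by apply: subset_trans DU _; exact: sub_thicken.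
rewrite [e in X in _ `<=` X]splitr; apply: subset_trans _ (@thicken_thicken _ _ _).
exact: thickenS.
Qed.

Lemma metric_definable_nbhs D U e : metric_definable d D -> open_in X U ->
  D `<=` U -> 0 < e ->
  exists V, [/\ open_in X V, D `<=` V, V `<=` U & V `<=` thicken d e D].
Proof.
move=> [clD hD] [B oB ->] DU e0; have [W [oW DW WD]] := hD e e0.
exists ((B `&` W) `&` X); split; first by exists (B `&` W) => //; exact: openI.
- by move=> p Dp; have [] := DU p Dp; do !split => //; exact: DW.
- by move=> p [[]].
- by move=> p [[_ /WD]].
Qed.

(** The cut is relatively clopen in [D]. A neighbourhood [V1] of it has no point within some [e'] of
    the rest of [D], so a point of [V1] that is close enough to [D] is close to the cut. *)
Lemma metric_definable_clopen D V : metric_definable d D -> D `<=` X ->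
  open_in X V -> closed (D `&` V) -> metric_definable d (D `&` V).
Proof.
move=> [clD hD] DX oV clDV; apply: metric_definable_in => // e e0.
have [V1 [oV1 DV1 V1V]] := open_in_between clDV oV (@subIsetr _ D V).
have [||q [Dq nVq] /V1V //|e' e'0 e'V] :=
    @closed_thicken_sub (D `\` V) (~` closure V1).
- exact: closedD_open_in.
- by apply: closed_openC; exact: closed_closure.
have [|W [oW DW WD]] := hD (Num.min e e'); first by rewrite lt_min e0.
exists (V1 `&` W); split.
- case: oV1 => B oB ->; exists (B `&` W); first exact: openI.
  by rewrite setIAC.
- by move=> q DVq; split; [exact: DV1|by case: DVq => /DW].
move=> q [V1q /WD[r Dr]]; rewrite lt_min => /andP[qr qr'].
exists r => //; split=> //; apply: contrapT => nVr.
by case: (e'V q); [exists r|exact: subset_closure].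
Qed.

Definition definable_network :=
  forall p U, open_in X U -> U p ->
    exists D, [/\ metric_definable d D, D p & D `<=` U].

(** Condition (vi), with the bound on the Hausdorff distance replaced by the two inclusions that it
    implies. *)
Definition open_approximable :=
  forall p U e, open_in X U -> U p -> 0 < e ->
    exists V F, [/\ open_in X V, V `<=` U, closed F /\ F `<=` X, V p &
                    V `<=` thicken d e F /\ F `<=` thicken d e V].

Definition definable_interpolation :=
  forall F U, closed F -> open_in X U -> F `<=` U ->
    exists D, [/\ metric_definable d D, F `<=` D & D `<=` U].

Lemma network_tame_basis : definable_network ->
  forall e p U, 0 < e -> open_in X U -> U p ->
    exists V, [/\ open_in X V, V p, V `<=` U & closure V `<=` thicken d e V].
Proof.
move=> net e p U e0 oU Up; have [D [defD Dp DU]] := net p U oU Up.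
(* Passing to the closure only gives distance at most [e / 2] to [D]; halving [e] restores the
   strict inequality. *)
have [|V [oV DV VU VD]] := @metric_definable_nbhs D U (e / 2) defD oU DU; first lra.
exists V; split=> //; first exact: DV.
move=> q /(closureS VD)/(closure_thicken (proj1 defD))[r Dr qr].
by exists r; [exact: DV|lra].
Qed.

(* If D contains {p} and X minus U but misses the frontier of V, cut D with V;
   if D contains the frontier and misses {p} and X minus U, fill D with V. *)
Lemma half_separation_network :
  (forall F G, closed F -> closed G -> F `<=` X -> G `<=` X -> F `&` G = set0 ->
     exists D, [/\ metric_definable d D, D `<=` X &
       (F `<=` D /\ D `&` G = set0) \/ (G `<=` D /\ D `&` F = set0)]) ->
  definable_network.
Proof.
move=> sep p U oU Up; have Xp := open_in_sub oU Up.
have [|V [oV pV VU]] := open_in_between (@closed_point p) oU; first by move=> _ ->.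
have {pV} Vp : V p := pV _ erefl.
have VX := open_in_sub oV; have clVX := closure_open_in oV.
have frV : closure V = V `|` (closure V `\` V).
  rewrite setUDr; have /setUidr -> := @subset_closure _ V.
  by rewrite setDv setD0.
pose F := [set p] `|` (X `\` U); pose G := closure V `\` V.
have clF : closed F by apply: closedU (@closed_point p) _; exact: closedD_open_in.
have clG : closed G by apply: closedD_open_in => //; exact: closed_closure.
have FX : F `<=` X by move=> q [->|[]].
have GX : G `<=` X by move=> q [/clVX].
have FG : F `&` G = set0.
  by apply/disjoints_subset => q [->|[_ nUq]] [/VU ? ?].
have [D [defD DX [[FD /disjoints_subset DG]|[GD /disjoints_subset DF]]]] :=
    sep F G clF clG FX GX FG.
  (* Since [D] misses the frontier, cutting with [V] or with its closure gives the same set, so the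
     cut is clopen in [D]. *)
  have DV : D `&` V = D `&` closure V.
    rewrite frV setIUr; apply/esym/setUidl => q [Dq Gq].
    by case: (DG q Dq).
  have clDV : closed (D `&` V).
    by rewrite DV; apply: closedI; [case: defD|exact: closed_closure].
  exists (D `&` V); split; last by move=> q [_ /subset_closure/VU].
    exact: metric_definable_clopen.
  by split=> //; apply: FD; left.
have DU : D `<=` U.
  move=> q Dq; apply: contrapT => nUq; apply: (DF q Dq); right.
  by split=> //; exact: DX.
exists (V `|` D); split; [|by left|by move=> q [/subset_closure/VU|/DU]].
apply: metric_definable_in => [|e e0].
  suff -> : V `|` D = closure V `|` D.
    by apply: closedU; [exact: closed_closure|case: defD].
  by rewrite frV -setUA; have /setUidr -> := GD.
(* [V] is already relatively open, so only the [D] part of the union has to be enlarged. *)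
have [W [oW DW WX WD]] := @metric_definable_nbhs D X e defD open_inT DX e0.
exists (V `|` W); split; first exact: open_inU.
  exact: setUS.
by rewrite thickenU; apply: setUSS => //; exact: sub_thicken.
Qed.

(** * Interpolation by successive approximation *)

Section Interpolation.
Context (approxX : open_approximable).

(** Finite unions preserve this property without loss in [e], so it spreads from small
    neighbourhoods to covers of compact sets. *)
Let approximated e V :=
  exists H, [/\ closed H, V `<=` thicken d e H & H `<=` thicken d e V].

Let approximated0 e : approximated e set0.
Proof. by exists set0; split => //; exact: closed0. Qed.

Let approximatedU e V V' :
  approximated e V -> approximated e V' -> approximated e (V `|` V').
Proof.
move=> [H [clH VH HV]] [H' [clH' VH' HV']]; exists (H `|` H'); split.
- exact: closedU.
- by rewrite thickenU; exact: setUSS.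
- by rewrite thickenU; exact: setUSS.
Qed.

(** Compactness induction on [K]: [open_approximable] gives a small approximated set around each
    [v], and finitely many of them suffice. The map [g] says in which sense they cover [K]: up to
    the complement of [X], or up to a thickening. *)
Let approximated_cover (g : set T -> set T) K V e :
  {homo g : S S' / S `<=` S'} -> 0 < e -> closed K -> open_in X V ->
  (forall x, K x -> exists2 v, V v &
     forall V', open_in X V' -> V' v -> nbhs x (g V')) ->
  exists V', [/\ open_in X V', V' `<=` V, approximated e V' & K `<=` g V'].
Proof.
move=> gS e0 clK oV KV.
apply: (@compact_ind _ K (fun S => exists V',
  [/\ open_in X V', V' `<=` V, approximated e V' & S `<=` g V'])).
- exact: (subclosed_compact clK (topometric_compact dT)).
- by exists set0; split => //; exact: open_in0.
- move=> S S' SS' [V' [? ? ? S'V']]; exists V'; split => //.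
  exact: subset_trans S'V'.
- move=> S1 S2 [V1 [oV1 V1V aV1 SV1]] [V2 [oV2 V2V aV2 SV2]].
  exists (V1 `|` V2); split; [exact: open_inU| |exact: approximatedU|].
    by rewrite subUset.
  rewrite subUset; split.
    by apply: (subset_trans SV1); apply: gS; exact: subsetUl.
  by apply: (subset_trans SV2); apply: gS; exact: subsetUr.
- move=> x /KV[v Vv xg].
  have [V' [H [oV' V'V [clH _] V'v [V'H HV']]]] := approxX oV Vv e0.
  by exists (g V'); [exact: xg|exists V'; split=> //; exists H].
Qed.

Let approximated_cover_sub F V e : 0 < e -> closed F -> open_in X V -> F `<=` V ->
  exists V', [/\ open_in X V', V' `<=` V, approximated e V' & F `<=` V'].
Proof.
move=> e0 clF oV FV.
(* Adding the complement of [X] turns relative neighbourhoods into neighbourhoods in the whole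
   space. *)
have [|x Fx|V' [oV' V'V aV' FV']] :=
    @approximated_cover (fun V => V `|` ~` X) F V e _ e0 clF oV.
- by move=> S S' SS'; exact: setSU.
- exists x; first exact: FV.
  move=> _ [B oB ->] [Bx _]; rewrite nbhsE; exists B => // q Bq.
  by have [Xq|nXq] := pselect (X q); [left|right].
exists V'; split=> // x Fx; case: (FV' x Fx) => // nXx.
by case: nXx; apply: (open_in_sub oV); exact: FV.
Qed.

(** [H] is compact, so a finite union of more finely approximated sets inside [V] comes within [e]
    of all of [H], and [V] is within [e] of [H]: hence the loss [e + e]. A second union is added to
    keep [F] covered. *)
Let approximated_refine F V e e' : closed F -> open_in X V -> F `<=` V ->
  0 < e' -> approximated e V ->
  exists V', [/\ open_in X V', V' `<=` V, F `<=` V', approximated e' V' &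
                 V `<=` thicken d (e + e) V'].
Proof.
move=> clF oV FV e'0 [H [clH VH HV]].
have [|x Hx|V1 [oV1 V1V aV1 HV1]] :=
    @approximated_cover (thicken d e) H V e' _ e'0 clH oV.
- by move=> S S' SS'; exact: thickenS.
- have [v Vv xv] := HV x Hx; exists v => // V' oV' V'v.
  by apply: open_nbhs_nbhs; split; [exact: open_thicken_open_in|exists v].
have [V2 [oV2 V2V aV2 FV2]] := approximated_cover_sub e'0 clF oV FV.
exists (V1 `|` V2); split.
- exact: open_inU.
- by rewrite subUset.
- by move=> x /FV2; right.
- exact: approximatedU.
apply: (subset_trans VH); apply: subset_trans _ (@thicken_thicken _ _ _).
apply: thickenS => //; apply: (subset_trans HV1); apply: thickenS => //.
Qed.

(* D is the intersection of the closures of a decreasing sequence V n: it is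
   close to V n by compactness, and V n is close to a closed set, hence so is
   its closure. *)
Lemma approximable_interpolation : definable_interpolation.
Proof.
move=> F U clF oU FU.
have [U0 [oU0 FU0 U0U]] := open_in_between clF oU FU.
pose e n : R := 2^-1 ^+ n.
have e0 n : 0 < e n by rewrite exprn_gt0// invr_gt0.
have eS n : e n.+1 + e n.+1 = e n by rewrite /e exprS; lra.
pose good n V := [/\ open_in X V, V `<=` U0, F `<=` V & approximated (e n) V].
pose next n V V' := good n.+1 V' /\ V' `<=` V /\ V `<=` thicken d (e n + e n) V'.
(* [choice] needs a successor for every pair; one that is not good gets [V] itself, for which the
   implication is vacuous. *)
have step nV : exists V', good nV.1 nV.2 -> next nV.1 nV.2 V'.
  case: nV => n V /=; have [[oV VU0 FV aV]|] := pselect (good n V); last by exists V.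
  have [V' [oV' V'V FV' aV' VV']] := approximated_refine clF oV FV (e0 n.+1) aV.
  by exists V' => _; split; [split=> //; exact: subset_trans VU0|].
have [f fP] := choice step.
have [V0 [oV0 V0U0 aV0 FV0]] := approximated_cover_sub (e0 0) clF oU0 FU0.
have g0 : good 0 V0 by [].
pose V := fix V n := if n is m.+1 then f (m, V m) else V0.
have gV n : good n (V n) by elim: n => // n /(fP (_, _))[].
have nV n : next n (V n) (V n.+1) by apply: (fP (_, _)).
have V_decr m n : (m <= n)%N -> V n `<=` V m.
  move=> /subnK <-; elim: (n - m)%N => // k IH.
  by apply: subset_trans IH; have [_ []] := nV (k + m)%N.
(* The losses form a geometric series: 2 [e n] + 4 [e n.+1] = 4 [e n]. *)
have V_near k n : V n `<=` thicken d (4 * e n) (V (k + n)%N).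
  elim: k n => [|k IH] n.
    by apply: sub_thicken; have := e0 n; lra.
  have [_ [_ /subset_trans]] := nV n; apply.
  have /subset_trans : thicken d (e n + e n) (V n.+1) `<=`
    thicken d (e n + e n) (thicken d (4 * e n.+1) (V (k + n.+1)%N)).
    exact: thickenS.
  apply; apply: subset_trans (@thicken_thicken _ _ _) _.
  by rewrite addnS; apply: thickenS => //; have := eS n; lra.
pose D := \bigcap_n closure (V n).
have clD : closed D by apply: closed_bigI => n _; exact: closed_closure.
exists D; split; last first.
- apply: subset_trans U0U; apply: subset_trans (bigcap_inf (I : setT 0%N)) _.
  exact: closureS.
- by move=> x Fx n _; apply: subset_closure; have [_ _ FV _] := gV n; exact: FV.
apply: metric_definable_in => // eps eps0.
(* 7 = 2 + 5: the neighbourhood of [D] is the thickening of [V n] by 2 [e n], and [V n] lies within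
   5 [e n] of [D]. *)
have [n en] : exists n, 7 * e n < eps.
  have [n ltn] : exists n, 7 / eps < 2 ^+ n.
    by exists (Num.bound (7 / eps)); exact: upper_nthrootP.
  by exists n; rewrite /e exprVn ltr_pdivrMr ?exprn_gt0// mulrC -ltr_pdivrMr.
have [oVn _ _ [H [clH VH HV]]] := gV n.
exists (thicken d (2 * e n) (V n) `&` X); split.
- by exists (thicken d (2 * e n) (V n)) => //; exact: open_thicken_open_in.
- move=> p Dp; split; last by apply: closure_open_in (Dp n _).
  have [q /HV[r Vr qr] pq] := closure_thicken clH (closureS VH (Dp n I)).
  by exists r => //; have := d_triangle p q r; lra.
suff VD : V n `<=` thicken d (5 * e n) D.
  move=> p [+ _]; move=> [q /VD[r Dr qr] pq]; exists r => //.
  by have := d_triangle p q r; lra.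
(* By [V_near] every later set has a point within 4 [e n] of [p]. Compactness yields one in all the
   closures, that is in [D], at distance at most 4 [e n] and so less than 5 [e n]. *)
move=> p Vp; pose C k := closure (V (k + n)%N) `&`
  [set q | exists2 r, [set p] r & d q r <= 4 * e n].
have [|k _|k _|j k _ _|q qC] :=
  @compact_bigcap_directed T nat setT C (topometric_compact dT).
- by exists 0%N.
- apply: closedI; first exact: closed_closure.
  exact/closed_le_thicken/closed_point.
- have [q Vq pq] := V_near k n p Vp; exists q; split; first exact: subset_closure.
  by exists p => //; rewrite dC; exact: ltW.
- exists (maxn j k) => //.
  move=> q [Vq qp]; split; split=> //; apply: closureS Vq; apply: V_decr.
    by rewrite leq_add2r leq_maxl.
  by rewrite leq_add2r leq_maxr.
exists q; last first.
  by have [_ [r -> ]] := qC 0%N I; rewrite dC; have := e0 n; lra.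
move=> m _; have [Vq _] := qC m I; apply: closureS Vq; apply: V_decr.
exact: leq_addr.
Qed.

End Interpolation.
End DefinableSubspace.
End Topometric.

(** * Formulas *)

(** Inhabitation and the lower bound exclude the default value of [inf]. Both hold for a formula
    evaluated along a structure. *)
Lemma infP (R : realType) (T : Type) (f : T -> R) (r : R) :
  inhabited T -> has_lbound (range f) -> inf (range f) < r <-> exists x, f x < r.
Proof.
move=> [x0] fb; split=> [|[x fx]].
  by move=> /inf_lt[|_ [x _ <-] fx]; [by exists (f x0), x0|exists x].
by apply: le_lt_trans fx; apply: ge_inf => //; exists x.
Qed.

(** The block to be quantified comes first, because quantifiers bind index 0; see
    [env_cat_consl]. *)
Definition env_cat (T : Type) (m k : nat) (b : 'I_m -> T) (a : 'I_k -> T) :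
    'I_(m + k) -> T :=
  fun i => match fintype.split i with inl j => b j | inr j => a j end.

Lemma env_cat_lshift (T : Type) (m k : nat) (b : 'I_m -> T) (a : 'I_k -> T) i :
  env_cat b a (lshift k i) = b i.
Proof. by rewrite /env_cat (unsplitK (inl i)). Qed.

Lemma env_cat_rshift (T : Type) (m k : nat) (b : 'I_m -> T) (a : 'I_k -> T) i :
  env_cat b a (rshift m i) = a i.
Proof. by rewrite /env_cat (unsplitK (inr i)). Qed.

Lemma env_cat0 (T : Type) (k : nat) (b : 'I_0 -> T) (a : 'I_k -> T) :
  env_cat b a = a.
Proof.
by apply/funext => i; rewrite -[RHS](env_cat_rshift b); congr env_cat; exact: val_inj.
Qed.

Lemma env_catE (T : Type) (m k : nat) (c : 'I_(m + k) -> T) :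
  c = env_cat (c \o lshift k) (c \o @rshift m k).
Proof.
apply/funext => i; case: (split_ordP i) => j ->; first by rewrite env_cat_lshift.
by rewrite env_cat_rshift.
Qed.

Lemma env_cat_lshiftK (T : Type) (m k : nat) (b : 'I_m -> T) (a : 'I_k -> T) :
  env_cat b a \o lshift k = b.
Proof. by apply/funext => i; exact: env_cat_lshift. Qed.

Lemma env_cat_rshiftK (T : Type) (m k : nat) (b : 'I_m -> T) (a : 'I_k -> T) :
  env_cat b a \o @rshift m k = a.
Proof. by apply/funext => i; exact: env_cat_rshift. Qed.

Lemma env_cons_lift (T : Type) (k : nat) (x : T) (e : 'I_k -> T) i :
  env_cons x e (lift ord0 i) = e i.
Proof. by rewrite /env_cons liftK. Qed.

Lemma env_cons0 (T : Type) (k : nat) (x : T) (e : 'I_k -> T) :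
  env_cons x e ord0 = x.
Proof. by rewrite /env_cons unlift_none. Qed.

Lemma env_consE (T : Type) (k : nat) (e : 'I_k.+1 -> T) :
  e = env_cons (e ord0) (e \o lift ord0).
Proof. by apply/funext => i; rewrite /env_cons; case: unliftP => [j|] ->. Qed.

Lemma env_cat_consl (T : Type) (m k : nat) (x : T) (b : 'I_m -> T) (a : 'I_k -> T) :
  env_cat (env_cons x b) a = env_cons x (env_cat b a).
Proof.
rewrite [LHS]env_consE; congr env_cons.
  rewrite -[RHS](env_cons0 x b) -[RHS](env_cat_lshift _ a); congr env_cat.
  exact: val_inj.
apply/funext => i /=; case: (split_ordP i) => j ->.
  rewrite env_cat_lshift -[RHS](env_cons_lift x b) -[RHS](env_cat_lshift _ a).
  by congr env_cat; exact: val_inj.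
rewrite env_cat_rshift -[RHS](env_cat_rshift (env_cons x b) a).
by congr env_cat; exact: val_inj.
Qed.

(** Carries a renaming under a quantifier: the bound variable is fixed and the others are
    shifted. *)
Lemma env_cons_comp (T : Type) (k l : nat) (s : 'I_k -> 'I_l) (x : T) (e : 'I_l -> T) :
  env_cons x e \o env_cons ord0 (lift ord0 \o s) = env_cons x (e \o s).
Proof.
apply/funext => i /=; rewrite {2 3}/env_cons; case: unliftP => [j|] _ /=.
  exact: env_cons_lift.
exact: env_cons0.
Qed.

Section Formulas.
Context (R : realType) (L : signature R) (M : structure L) (C : Type) (c : C -> M).

(** The arguments of a connective range in a compact box, on which a continuous function is bounded.
    The bound makes quantifiers true infima and suprema, and makes type spaces compact. *)
Lemma formula_bounded k (p : formula L C k) :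
  exists B, forall e, `|feval c p e| <= B.
Proof.
elim: k / p => [k t1 t2|k P ts|k m u cu ps IH|k p [B pB]|k p [B pB]].
- exists (diam L) => e /=; rewrite ger0_norm ?mdist_ge0//.
  exact: carrier_bounded.
- exists (Num.max `|psym_lower P| `|psym_upper P|) => e /=.
  have /andP[lo up] := @pint_range _ _ M P (fun i => teval c e (ts i)).
  have := ler_norm (- psym_lower P); have := ler_norm (psym_upper P).
  rewrite normrN => ? ?; rewrite ler_norml lerNl !le_max.
  by apply/andP; split; apply/orP; [left|right]; lra.
- have [B psB] := choice IH.
  have : compact [set v : 'rV[R]_m | forall i, `[- B i, B i]%classic (v ord0 i)].
    apply: (@rV_compact R m (fun i => `[- B i, B i]%classic)) => i.
    exact: segment_compact.
  move=> /(continuous_compact (continuous_subspaceT cu))/compact_bounded.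
  move=> /ex_strict_bound_gt0[D _ uD]; exists D => e /=; apply/ltW/uD.
  exists (\row_i feval c (ps i) e) => // i /=.
  by rewrite mxE in_itv /= -ler_norml.
- have [x0] := carrier_inh M; exists B => e /=.
  have pB' x : - B <= feval c p (env_cons x e) <= B by rewrite -ler_norml.
  rewrite ler_norml; apply/andP; split.
    by apply: lb_le_inf => [|_ [x _ <-]]; [eexists; exists x0|case/andP: (pB' x)].
  apply: (@le_trans _ _ (feval c p (env_cons x0 e))); last by case/andP: (pB' x0).
  by apply: ge_inf; [exists (- B) => _ [x _ <-]; case/andP: (pB' x)|exists x0].
- have [x0] := carrier_inh M; exists B => e /=.
  have pB' x : - B <= feval c p (env_cons x e) <= B by rewrite -ler_norml.
  rewrite ler_norml; apply/andP; split; last first.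
    by apply: ge_sup => [|_ [x _ <-]]; [eexists; exists x0|case/andP: (pB' x)].
  apply: (@le_trans _ _ (feval c p (env_cons x0 e))); first by case/andP: (pB' x0).
  by apply: ub_le_sup; [exists B => _ [x _ <-]; case/andP: (pB' x)|exists x0].
Qed.

Lemma term_rename k l (s : 'I_k -> 'I_l) (t : term L C k) :
  exists t', forall e, teval c e t' = teval c (e \o s) t.
Proof.
elim: t => [i|a|f ts /choice[ts' ts'E]].
- by exists (tVar L C (s i)).
- by exists (tPar L l a).
- by exists (tApp ts') => e /=; congr fint; apply/funext => i.
Qed.

Lemma formula_rename k l (s : 'I_k -> 'I_l) (p : formula L C k) :
  exists q, forall e, feval c q e = feval c p (e \o s).
Proof.
elim: k / p l s => [k t1 t2|k P ts|k m u cu ps IH|k p IH|k p IH] l s.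
- have [t1' t1E] := term_rename s t1; have [t2' t2E] := term_rename s t2.
  by exists (fDist t1' t2') => e /=; rewrite t1E t2E.
- have [ts' ts'E] := choice (fun i => term_rename s (ts i)).
  by exists (fPred ts') => e /=; congr pint; apply/funext => i.
- have [qs qsE] := choice (fun i => IH i l s).
  by exists (fConn cu qs) => e /=; congr u; apply/rowP => i; rewrite !mxE.
- have [q qE] := IH _ (env_cons ord0 (lift ord0 \o s)).
  exists (fInf q) => e /=; congr inf; apply: eq_imagel => x _.
  by rewrite qE env_cons_comp.
- have [q qE] := IH _ (env_cons ord0 (lift ord0 \o s)).
  exists (fSup q) => e /=; congr sup; apply: eq_imagel => x _.
  by rewrite qE env_cons_comp.
Qed.

Lemma formula_comp (u : R -> R) k (p : formula L C k) : continuous u ->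
  exists q, forall e, feval c q e = u (feval c p e).
Proof.
move=> cu; have cu' : continuous (fun v : 'rV[R]_1 => u (v ord0 ord0)).
  move=> v; apply: (@continuous_comp _ _ _ (fun v : 'rV[R]_1 => v ord0 ord0) u).
    exact: coord_continuous.
  exact: cu.
by exists (fConn cu' (fun=> p)) => e /=; rewrite mxE.
Qed.

Lemma formula_max k (p q : formula L C k) :
  exists r, forall e, feval c r e = Num.max (feval c p e) (feval c q e).
Proof.
have cu : continuous (fun v : 'rV[R]_2 => Num.max (v ord0 0) (v ord0 1)).
  move=> v; apply: (@continuous_max _ _ (fun v : 'rV[R]_2 => v ord0 0)
    (fun v : 'rV[R]_2 => v ord0 1)); exact: coord_continuous.
by exists (fConn cu (fun i => if i == 0 then p else q)) => e /=; rewrite !mxE.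
Qed.

Lemma formula_bigmax (I : Type) (s : seq I) k (p : I -> formula L C k) :
  exists q, forall e, feval c q e = \big[Num.max/0]_(i <- s) feval c (p i) e.
Proof.
elim: s => [|i s [q qE]].
  have cu : continuous (fun _ : 'rV[R]_0 => 0 : R).
    by apply: cst_continuous.
  have [f] : inhabited ('I_0 -> formula L C k) by constructor; case.
  by exists (fConn cu f) => e; rewrite big_nil.
have [r rE] := formula_max (p i) q.
by exists r => e; rewrite big_cons rE qE.
Qed.

(** Iterates [fInf] over a block of variables. Only strict inequalities have witnesses, since the
    infimum may fail to be attained. *)
Lemma formula_inf m k (p : formula L C (m + k)) :
  exists q : formula L C k, forall e r,
    feval c q e < r <-> exists b, feval c p (env_cat b e) < r.
Proof.
elim: m p => [|m IH] p.
  have [b0] : inhabited ('I_0 -> M) by constructor; case.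
  by exists p => e r; split=> [per|[b]]; [exists b0|]; rewrite env_cat0.
have [q qE] := IH (fInf p : formula L C (m + k)).
have pinf b e r : feval c (fInf p : formula L C (m + k)) (env_cat b e) < r <->
    exists x, feval c p (env_cat (env_cons x b) e) < r.
  rewrite /= infP; last 2 first.
  - exact: carrier_inh.
  - have [B pB] := formula_bounded p; exists (- B) => _ [x _ <-].
    by have := pB (env_cons x (env_cat b e)); rewrite ler_norml => /andP[].
  by split=> -[x px]; exists x; move: px; rewrite env_cat_consl.
exists q => e r; rewrite qE; split=> [[b /pinf[x px]]|[b pb]].
  by exists (env_cons x b).
by exists (b \o lift ord0); apply/pinf; exists (b ord0); rewrite -env_consE.
Qed.

Lemma formula_tuple_dist n :
  exists q : formula L C (n + n), forall a b : 'I_n -> M,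
    feval c q (env_cat b a) = tuple_dist a b.
Proof.
have [q qE] := formula_bigmax (index_enum 'I_n)
  (fun i => fDist (tVar L C (rshift n i)) (tVar L C (lshift n i))).
exists q => a b; rewrite qE /tuple_dist; apply: eq_bigr => i _ /=.
by rewrite env_cat_lshift env_cat_rshift.
Qed.

End Formulas.

(** * Type spaces over a small set of parameters *)

Lemma cvg_initial (S : choiceType) (T : topologicalType) (f : S -> T)
    (F : set_system S) (s : S) : Filter F ->
  F --> (s : initial_topology f) <-> f @ F --> f s.
Proof.
move=> FF; split=> [Fs|Fs].
  by apply: cvg_trans (@initial_continuous _ _ f s); exact: cvg_app.
move=> A /= [_ [[B oB <-] Bfs BA]]; rewrite nbhs_filterE.
by apply: filterS BA _; apply: Fs; exact: open_nbhs_nbhs.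
Qed.

Lemma pair_hausdorff (T U : topologicalType) :
  hausdorff_space T -> hausdorff_space U -> hausdorff_space (T * U)%type.
Proof.
move=> hT hU [a b] [a' b'] ab; congr pair; [apply: hT|apply: hU] => P Q aP a'Q.
  have [z [Pz Qz]] := ab _ _ (cvg_fst aP) (cvg_fst a'Q).
  by exists z.1.
have [z [Pz Qz]] := ab _ _ (cvg_snd aP) (cvg_snd a'Q).
by exists z.2.
Qed.

Section TupleDistance.
Context (R : realType) (M : metricType R).

Lemma tuple_dist_ge0 n (a b : 'I_n -> M) : 0 <= tuple_dist a b.
Proof.
by rewrite /tuple_dist; elim/big_rec: _ => // i x _ x0; rewrite le_max x0 orbT.
Qed.

Lemma tuple_distxx n (a : 'I_n -> M) : tuple_dist a a = 0.
Proof.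
rewrite /tuple_dist; elim/big_rec: _ => // i x _ ->.
by rewrite mdistxx maxxx.
Qed.

Lemma tuple_distC n (a b : 'I_n -> M) : tuple_dist a b = tuple_dist b a.
Proof. by apply: eq_bigr => i _; rewrite metric_sym. Qed.

Lemma tuple_dist_ge n (a b : 'I_n -> M) i : mdist (a i) (b i) <= tuple_dist a b.
Proof. by rewrite /tuple_dist (bigD1 i)//= le_max lexx. Qed.

Lemma tuple_dist_triangle n (a b c : 'I_n -> M) :
  tuple_dist a c <= tuple_dist a b + tuple_dist b c.
Proof.
rewrite {1}/tuple_dist; elim/big_rec: _ => [|i x _ xabc].
  by rewrite addr_ge0 ?tuple_dist_ge0.
rewrite ge_max xabc andbT; apply: le_trans (metric_triangle _ (b i) _) _.
by apply: lerD; exact: tuple_dist_ge.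
Qed.

Lemma tuple_dist_eq0 n (a b : 'I_n -> M) : tuple_dist a b = 0 -> a = b.
Proof.
move=> ab; apply/funext => i; apply: mdist_positivity; apply/eqP.
by rewrite eq_le mdist_ge0 andbT -ab tuple_dist_ge.
Qed.

End TupleDistance.

Section TypeSpace.
Context (R : realType) (L : signature R) (M : structure L) (A : set M).

Lemma fatteningE n : @fattening R L M A n = thicken (@type_dist R L M A n).
Proof.
apply/funext => e; apply/funext => Q; apply/seteqP; split=> p; rewrite /fattening /=.
  by move=> /ereal_inf_lt[_ [q Qq <-]]; rewrite lte_fin; exists q.
move=> [q Qq pq]; apply: (@le_lt_trans _ _ (type_dist p q)%:E).
  by apply: ereal_inf_lbound; exists q.
by rewrite lte_fin.
Qed.

Lemma definableE n : @definable R L M A n = metric_definable (@type_dist R L M A n).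
Proof. by apply/funext => D; rewrite /definable fatteningE. Qed.

Lemma hausdorff_dist_lt n e (P Q : set (type_space A n)) :
  (hausdorff_dist P Q < e%:E)%E -> P `<=` fattening e Q /\ Q `<=` fattening e P.
Proof.
rewrite /hausdorff_dist gt_max => /andP[PQ QP]; split=> p Pp; rewrite /fattening /=.
  by apply: le_lt_trans PQ; apply: ereal_sup_ubound; exists p.
by apply: le_lt_trans QP; apply: ereal_sup_ubound; exists p.
Qed.

Lemma hausdorff_dist_le n e (P Q : set (type_space A n)) :
  P `<=` fattening e Q -> Q `<=` fattening e P -> (hausdorff_dist P Q <= e%:E)%E.
Proof.
move=> PQ QP; rewrite /hausdorff_dist ge_max; apply/andP; split.
  by apply: ge_ereal_sup => _ [p /PQ pQ <-]; exact: ltW.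
by apply: ge_ereal_sup => _ [p /QP pP <-]; exact: ltW.
Qed.

(** Unfolds two layers: the subspace topology and the product topology. *)
Lemma cvg_type n (F : set_system (type_space A n)) (p : type_space A n) :
  Filter F ->
  F --> p <-> forall q, (fun r : type_space A n => set_val r q) @ F --> set_val p q.
Proof.
move=> FF; rewrite cvg_initial cvg_sup; split=> Fp q; have := Fp q.
  by rewrite cvg_initial.
by move=> Fpq; apply/cvg_initial.
Qed.

Lemma type_eval_continuous n (q : formula_over A n) :
  continuous (fun r : type_space A n => set_val r q : R).
Proof. by move=> p; apply: (iffLR (@cvg_type n (nbhs p) p _)). Qed.

Lemma type_ext n (p q : type_space A n) :
  (forall r, set_val p r = set_val q r) -> p = q.
Proof. by move=> pq; apply: val_inj; apply/funext => r; exact: pq. Qed.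

Lemma type_space_hausdorff n : hausdorff_space (type_space A n).
Proof.
move=> p q pq; apply: type_ext => r; apply: (@Rhausdorff R) => U V pU qV.
have [s [sU sV]] := pq _ _ (@type_eval_continuous n r p _ pU)
  (@type_eval_continuous n r q _ qV).
by exists (set_val s r).
Qed.

Lemma tuple_is_complete_type n (a : 'I_n -> M) :
  is_complete_type (fun q : formula_over A n => eval_over q a).
Proof. by move=> m q e e0; exists a => i; rewrite subrr normr0. Qed.

Definition tp n (a : 'I_n -> M) : type_space A n :=
  exist _ (fun q : formula_over A n => eval_over q a)
    (mem_set (tuple_is_complete_type a)).

Lemma tpE n (a : 'I_n -> M) q : set_val (tp a) q = eval_over q a.
Proof. by rewrite set_valE. Qed.

Lemma realizesE n (a : 'I_n -> M) p : realizes a p <-> p = tp a.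
Proof.
split=> [ap|-> q]; last by rewrite tpE.
by apply: type_ext => q; rewrite tpE ap.
Qed.

Lemma type_valP n (p : type_space A n) :
  is_complete_type (set_val p : formula_over A n -> R).
Proof. by have := set_valP p; rewrite set_valE. Qed.

(** Along an ultrafilter the value of each formula converges, being bounded. The limit is a type
    because finitely many conditions are met within [e / 2] by one type of the filter, which is
    itself satisfied within [e / 2] by a tuple. *)
Lemma type_space_compact n : compact [set: type_space A n].
Proof.
rewrite compact_ultra => F FU _.
have /choice[l lP] (q : formula_over A n) :
    exists l : R, (fun r : type_space A n => set_val r q : R) @ F --> l.
  have [B qB] := formula_bounded (set_val : A -> M) q.
  pose ev (r : type_space A n) : R := set_val r q.
  have [|l [_ cl]] := @segment_compact R (- B - 1) (B + 1) (ev @ F) _; last first.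
    exists l => U lU; have [//|FnU] := in_ultra_setVsetC (ev @^-1` U) FU.
    by have [x []] := cl (~` U) U FnU lU.
  (* A type prescribes a value that some tuple attains only up to 1, hence the margin around [B]. *)
  have evB : setT `<=` ev @^-1` `[- B - 1, B + 1].
    move=> r _ /=; rewrite /ev in_itv /=.
    have [a /(_ ord0)] := @type_valP _ r 1 (fun=> q) 1 ltr01.
    have := qB a; rewrite /eval_over ler_norml ltr_norml.
    by move=> /andP[? ?] /andP[? ?]; lra.
  exact: filterS evB filterT.
have cl : is_complete_type l.
  move=> m q e e0.
  have : \forall r \near F, forall i : 'I_m,
      `|(set_val r : formula_over A n -> R) (q i) - l (q i)| < e / 2.
    apply: filter_forall => i.
    have /cvgrPdist_lt /(_ (e / 2)) := lP (q i); rewrite near_simpl => h.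
    have e20 : 0 < e / 2 by lra.
    by apply: filterS (h e20) => r /=; rewrite distrC.
  move=> /filter_ex[r rl].
  have [|a ar] := @type_valP _ r m q (e / 2); first lra.
  exists a => i; have := ar i; have := rl i.
  have := ler_distD (set_val r (q i)) (eval_over (q i) a) (l (q i)); lra.
exists (exist _ l (mem_set cl) : type_space A n); split=> //.
by apply/cvg_type => q; rewrite set_valE /=; exact: lP.
Qed.

End TypeSpace.

(** * Types in a saturated model *)

Section Saturated.
Context (R : realType) (L : signature R) (K : Type) (M : structure L).
Context (satM : saturated K M) (A : set M) (smallA : small K A).

(** The gateway for saturation: types are replaced by tuples of [M] from here on. *)
Lemma tp_surj n (p : type_space A n) : exists a, p = tp A a.
Proof. by have [a /realizesE] := satM smallA p; exists a. Qed.

Lemma type_nbhsP n (p : type_space A n) U : nbhs p U ->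
  exists2 q : formula_over A n, set_val p q < 0 &
    forall r : type_space A n, set_val r q < 0 -> U r.
Proof.
move=> pU.
pose F := filter_from [set q : formula_over A n | set_val p q < 0]
  (fun q => [set r : type_space A n | set_val r q < 0]).
have FF : Filter F.
  apply: filter_from_filter.
    (* The empty maximum merely supplies a formula to compose with the constant -1, whose sublevel
       set is the whole space. *)
    have [b _] := formula_bigmax (set_val : A -> M) [::]
      (fun i : False => False_rect (formula_over A n) i).
    have cu : continuous (fun _ : R => -1 : R) by move=> x; apply: cst_continuous.
    have [q qE] := formula_comp (set_val : A -> M) b cu.
    exists q => /=; have [a ->] := tp_surj p.
    rewrite tpE /eval_over qE; lra.
  move=> q1 q2 /= p1 p2; have [q qE] := formula_max (set_val : A -> M) q1 q2.
  have qE' (r : type_space A n) :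
      (set_val r q < 0) = (set_val r q1 < 0) && (set_val r q2 < 0).
    by have [a ->] := tp_surj r; rewrite !tpE /eval_over qE gt_max.
  exists q => /=; first by rewrite qE' p1 p2.
  by move=> r /=; rewrite qE' => /andP[].
have : F --> p.
  apply/cvg_type => q; apply/cvgrPdist_lt => e e0.
  have cu : continuous (fun x : R => `|set_val p q - x| - e).
    move=> x; apply: cvgB; last exact: cvg_cst.
    by apply: cvg_norm; apply: cvgB; [exact: cvg_cst|exact: cvg_id].
  have [q' qE] := formula_comp (set_val : A -> M) q cu.
  have qE' (r : type_space A n) : set_val r q' = `|set_val p q - set_val r q| - e :> R.
    by have [a ->] := tp_surj r; rewrite !tpE /eval_over qE.
  exists q' => /=; first by rewrite qE' subrr normr0; lra.
  by move=> r /=; rewrite qE' subr_lt0.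
by move=> /(_ _ pU) [q pq qU]; exists q.
Qed.

Lemma type_dist_le n (a b : 'I_n -> M) : type_dist (tp A a) (tp A b) <= tuple_dist a b.
Proof.
apply: ge_inf; first by exists 0 => _ [a' _ [b' _ <-]]; exact: tuple_dist_ge0.
by exists a; [exact/realizesE|exists b => //; exact/realizesE].
Qed.

Lemma type_dist_lt n (p q : type_space A n) e : type_dist p q < e ->
  exists a b, [/\ p = tp A a, q = tp A b & tuple_dist a b < e].
Proof.
move=> /inf_lt[|_ [a /realizesE pa [b /realizesE qb <-]] abe].
  have [a pa] := tp_surj p; have [b qb] := tp_surj q.
  by exists (tuple_dist a b), a; [exact/realizesE|exists b => //; exact/realizesE].
by exists a, b.
Qed.

(* phi < 0 defines a neighbourhood of a point of U inside U, and
   inf_y max(d(x, y) - e, phi(y)) < 0 an open set of types at distance < e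
   from it, which does not depend on the realization of x. *)
Lemma open_thicken_formula n e (U : set (type_space A n)) p : open U ->
  thicken (@type_dist R L M A n) e U p ->
  exists2 q : formula_over A n, set_val p q < 0 &
    forall a : 'I_n -> M, set_val (tp A a) q < 0 ->
      exists2 b, U (tp A b) & tuple_dist a b < e.
Proof.
move=> oU [r Ur /type_dist_lt[a [b [-> rE abe]]]]; subst r.
have [phi phib phiU] := type_nbhsP (open_nbhs_nbhs (conj oU Ur)).
have [phi' phi'E] := formula_rename (set_val : A -> M) (lshift n) phi.
have [dist distE] := formula_tuple_dist (set_val : A -> M) n.
have cu : continuous (fun x : R => x - e).
  by move=> x; apply: cvgB; [exact: cvg_id|exact: cvg_cst].
have [dist' dist'E] := formula_comp (set_val : A -> M) dist cu.
have [psi psiE] := formula_max (set_val : A -> M) dist' phi'.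
have [q qE] := formula_inf (set_val : A -> M) psi.
have psi_lt a' b' : feval (set_val : A -> M) psi (env_cat b' a') < 0 <->
    tuple_dist a' b' < e /\ set_val (tp A b') phi < 0.
  rewrite psiE gt_max dist'E distE phi'E tpE /eval_over.
  by rewrite env_cat_lshiftK subr_lt0; split=> /andP.
exists q; first by rewrite tpE; apply/qE; exists b; apply/psi_lt.
by move=> a'; rewrite tpE => /qE[b' /psi_lt[ab' /phiU Ub']]; exists b'.
Qed.

Lemma open_thicken_type n e (U : set (type_space A n)) : open U ->
  open (thicken (@type_dist R L M A n) e U).
Proof.
move=> oU; rewrite openE => p /(open_thicken_formula oU)[q pq qU].
have q_lt0 : nbhs p [set r : type_space A n | set_val r q < 0].
  exact: type_eval_continuous (lt_nbhsl pq).
apply: filterS q_lt0 => r /=.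
have [a ->] := tp_surj r => /qU[b Ub abe]; exists (tp A b) => //.
by apply: le_lt_trans abe; exact: type_dist_le.
Qed.

(** Restriction of types along a map of variables, computed on a chosen realization; [projE] shows
    that it does not depend on the choice. *)
Let proj n m (s : 'I_n -> 'I_m) (p : type_space A m) : type_space A n :=
  tp A (projT1 (cid (tp_surj p)) \o s).

Let projE n m (s : 'I_n -> 'I_m) (a : 'I_m -> M) : proj s (tp A a) = tp A (a \o s).
Proof.
rewrite /proj; case: cid => b /= ab; apply: type_ext => q.
have [q' q'E] := formula_rename (set_val : A -> M) s q.
rewrite !tpE /eval_over -!q'E.
by have := congr1 (fun p => set_val p q') ab; rewrite !tpE.
Qed.

Let proj_continuous n m (s : 'I_n -> 'I_m) : continuous (@proj n m s).
Proof.
move=> p; apply: (iffRL (@cvg_type _ _ _ _ _ (proj s @ nbhs p) _ _)) => q.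
have [q' q'E] := formula_rename (set_val : A -> M) s q.
have projq r : set_val (proj s r) q = set_val r q' :> R.
  by have [a ->] := tp_surj r; rewrite projE !tpE /eval_over q'E.
have evE : (fun r => set_val (proj s r) q : R) = (fun r => set_val r q').
  by apply/funext => r; exact: projq.
suff : (fun r => set_val (proj s r) q : R) @ nbhs p -->
  (set_val (proj s p) q : R) by [].
by rewrite projq evE; exact: type_eval_continuous.
Qed.

(** The joint types of realizations of [p] and [q] form a compact set [S], on which the distance
    formula is continuous; a realization of a minimizing joint type is the required pair. *)
Lemma type_dist_attained n (p q : type_space A n) :
  exists a b, [/\ p = tp A a, q = tp A b & tuple_dist a b = type_dist p q].
Proof.
have [a0 pa0] := tp_surj p; have [b0 qb0] := tp_surj q.
have [dist distE] := formula_tuple_dist (set_val : A -> M) n.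
pose S := [set r : type_space A (n + n) |
  proj (@rshift n n) r = p /\ proj (lshift n) r = q].
have S_cat a b : S (tp A (env_cat b a)) <-> p = tp A a /\ q = tp A b.
  by rewrite /S /= !projE env_cat_lshiftK env_cat_rshiftK; split=> -[-> ->].
have cS : compact S.
  apply: (subclosed_compact _ (@type_space_compact _ _ M A (n + n))) => //.
  have cl1 (x : type_space A n) : closed [set x].
    exact/accessible_closed_set1/hausdorff_accessible/type_space_hausdorff.
  rewrite /S; apply: closedI.
    by apply: (@preimage_closed _ _ (proj (@rshift n n)) [set p]) => //.
  by apply: (@preimage_closed _ _ (proj (lshift n)) [set q]) => //.
have [||r /[!inE] Sr rmin] :=
  @compact_EVT_min _ R (fun r : type_space A (n + n) => set_val r dist) S _ cS.
- by exists (tp A (env_cat b0 a0)); apply/S_cat.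
- by apply: continuous_subspaceT; exact: type_eval_continuous.
have [c rc] := tp_surj r.
move: Sr rmin; rewrite rc (env_catE c) => /S_cat[pc qc] rmin.
exists (c \o @rshift n n), (c \o lshift n); split=> //.
apply/eqP; rewrite eq_le; apply/andP; split; last by rewrite pc qc type_dist_le.
apply: lb_le_inf.
  exists (tuple_dist a0 b0), a0; first exact/realizesE.
  by exists b0 => //; exact/realizesE.
move=> _ [a /realizesE pa [b /realizesE qb <-]].
have := rmin (tp A (env_cat b a)); rewrite inE => /(_ (iffRL (S_cat _ _) (conj pa qb))).
by rewrite !tpE /eval_over !distE.
Qed.

(** By attainment, the set is the continuous image of the closed set of joint types whose distance
    formula is at most [e]. *)
Lemma type_dist_closed n e :
  closed [set pq : type_space A n * type_space A n | type_dist pq.1 pq.2 <= e].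
Proof.
have [dist distE] := formula_tuple_dist (set_val : A -> M) n.
have -> : [set pq : type_space A n * type_space A n | type_dist pq.1 pq.2 <= e] =
    (fun r => (proj (@rshift n n) r, proj (lshift n) r)) @`
      [set r : type_space A (n + n) | set_val r dist <= e].
  rewrite eqEsubset; split=> [[p q] /= pqe|_ [r /= re <-]] /=.
    have [a [b [pa qb ab]]] := type_dist_attained p q.
    exists (tp A (env_cat b a)); first by rewrite /= tpE /eval_over distE ab.
    by rewrite !projE pa qb env_cat_lshiftK env_cat_rshiftK.
  have [c rc] := tp_surj r.
  move: re; rewrite rc !projE tpE {1}(env_catE c) /eval_over distE.
  by apply: le_trans; exact: type_dist_le.
apply: compact_closed; first by apply: pair_hausdorff; exact: type_space_hausdorff.
apply: continuous_compact.
  apply: continuous_subspaceT => r.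
  exact: cvg_pair (@proj_continuous _ _ (@rshift n n) r)
    (@proj_continuous _ _ (lshift n) r).
apply: (subclosed_compact _ (@type_space_compact _ _ M A (n + n))) => //.
apply: (@preimage_closed _ _ (fun r : type_space A (n + n) => set_val r dist)
  [set x | x <= e]).
  by move=> r _; exact: type_eval_continuous.
exact: closed_le.
Qed.

(* Any realization a of p has b near it with tp b close to q, and b has c near it
   with tp c close to r; conclude with lower semicontinuity. *)
Lemma type_dist_triangle n (p q r : type_space A n) :
  type_dist p r <= type_dist p q + type_dist q r.
Proof.
apply/ler_addgt0Pr => e e0.
pose S := [set r' : type_space A n |
  type_dist p r' <= type_dist p q + type_dist q r + e].
have clS : closed S.
  apply: (@preimage_closed _ _ (fun r' => (p, r'))
    [set pq | type_dist pq.1 pq.2 <= type_dist p q + type_dist q r + e]).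
    move=> r' _.
    have pr' : (fun _ : type_space A n => p) @ nbhs r' --> p by exact: cvg_cst.
    exact: (cvg_pair pr' (@cvg_id _ (nbhs r'))).
  exact: type_dist_closed.
apply: (clS r) => U; rewrite nbhsE => -[V [oV Vr] VU].
have oW := open_thicken_type (type_dist q r + e / 2) oV.
have [|phi phip phiW] := @open_thicken_formula n (type_dist p q + e / 2) _ p oW.
  by exists q; [exists r => //; lra|lra].
have [a pa] := tp_surj p; move: phip; rewrite pa => /phiW[b bW ab].
have [psi psib psiV] := open_thicken_formula oV bW.
have [c Vc bc] := psiV b psib.
exists (tp A c); split; last exact: VU.
rewrite /S /= pa; apply: le_trans (type_dist_le _ _) _; rewrite -pa.
by have := tuple_dist_triangle a b c; lra.
Qed.

Lemma type_space_topometric n : topometric (@type_dist R L M A n).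
Proof.
split.
- exact: type_space_compact.
- exact: type_space_hausdorff.
- move=> p; have [a ->] := tp_surj p; apply/eqP; rewrite eq_le; apply/andP; split.
    by rewrite -(tuple_distxx a) type_dist_le.
  have [b [c [_ _ <-]]] := type_dist_attained (tp A a) (tp A a).
  exact: tuple_dist_ge0.
- suff le (p q : type_space A n) : type_dist p q <= type_dist q p.
    by move=> p q; apply/eqP; rewrite eq_le !le.
  have [a [b [-> -> <-]]] := type_dist_attained q p.
  by rewrite tuple_distC type_dist_le.
- exact: type_dist_triangle.
- move=> p q; have [a [b [-> -> <-]]] := type_dist_attained p q.
  by move=> /tuple_dist_eq0 ->.
- exact: type_dist_closed.
- by move=> e U; exact: open_thicken_type.
Qed.

End Saturated.

(** * Equivalent forms of being dictionaric *)

Theorem proposition4p3 (R : realType) (L : signature R) (K : Type)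
    (M : structure L) (hM : monster K M) (A : set M) (hA : small K A) (n : nat)
    (X : set (type_space A n)) (hX : X = setT \/ definable X) :
  [<->
   (* (i) *)
   dictionaric X;
   (* (ii) *)
   forall e : R, 0 < e ->
     exists2 B : set (set (type_space A n)), basis_in X B &
       forall U, B U -> closure U `<=` fattening e U;
   (* (iii) *)
   forall F G : set (type_space A n), closed F -> closed G ->
     F `<=` X -> G `<=` X -> F `&` G = set0 ->
     exists D E : set (type_space A n),
       [/\ definable D /\ D `<=` X, definable E /\ E `<=` X, D `&` E = set0,
           F `<=` D & G `<=` E];
   (* (iv) *)
   forall F G : set (type_space A n), closed F -> closed G ->
     F `<=` X -> G `<=` X -> F `&` G = set0 ->
     exists D : set (type_space A n), [/\ definable D, D `<=` X &
       (F `<=` D /\ D `&` G = set0) \/ (G `<=` D /\ D `&` F = set0)];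
   (* (v) *)
   forall (p : type_space A n) (U : set (type_space A n)),
     open_in X U -> U p ->
     exists D : set (type_space A n), [/\ definable D, D p & D `<=` U];
   (* (vi) *)
   forall (p : type_space A n) (U : set (type_space A n)) (e : R),
     open_in X U -> U p -> 0 < e ->
     exists V F : set (type_space A n),
       [/\ open_in X V, V `<=` U, closed F /\ F `<=` X, V p &
           (hausdorff_dist V F < e%:E)%E]].
Proof.
have [_ satM _] := hM.
have dT := type_space_topometric satM hA n.
have defX : metric_definable (@type_dist R L M A n) X.
  case: hX => [->|]; first exact: metric_definableT.
  by rewrite definableE.
have clX : closed X by case: defX.
have between F U : closed F -> open_in X U -> F `<=` U ->
    exists V, [/\ open_in X V, F `<=` V & closure V `<=` U].
  exact: (open_in_between dT defX).
rewrite /dictionaric definableE fatteningE.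
(* The implications are proved in cyclic order: (i) to (ii) goes through the network of (v), (ii) to
   (iii) through approximation as in (vi), and (v) to (vi) through the sets of (ii). *)
tfae.
- move=> dict e e0.
  have net : definable_network (@type_dist R L M A n) X.
    move=> p U oU Up; have [|D [defD DX [V [_ Vp VD]] DF]] :=
      dict p (X `\` U) (open_in_sub oU Up) (closedD_open_in clX (@subset_refl _ X) oU)
        (@subDsetl _ X U).
      by case.
    exists D; split=> //; first exact: VD.
    move=> q Dq; apply: contrapT => nUq.
    by move/disjoints_subset : DF => /(_ q Dq); apply; split=> //; exact: DX.
  exists [set V | open_in X V /\ closure V `<=` thicken (@type_dist R L M A n) e V].
    split=> [V []//|p W oW Wp].
    have [V [oV Vp VW Vtame]] := network_tame_basis dT net e0 oW Wp.
    by exists V; split.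
  by move=> V [].
- move=> basis.
  have approx : open_approximable (@type_dist R L M A n) X.
    move=> p U e oU Up e0; have [B [Bo Bb] Btame] := basis e e0.
    have [V [BV Vp VU]] := Bb p U oU Up.
    exists V, (closure V); split=> //; first exact: Bo.
      by split; [exact: closed_closure|exact: (closure_open_in defX (Bo _ BV))].
    split; last exact: Btame.
    by apply: (subset_trans (@subset_closure _ V)); exact: (sub_thicken dT).
  have interp := approximable_interpolation dT defX approx.
  move=> F G clF clG FX GX FG.
  (* [V] serves as a buffer: [D] is found inside it and [E] outside its closure. *)
  have [||V [oV FV VG]] := between F (X `\` G) clF.
  + exact: open_inDclosed.
  + by move=> p Fp; split; [exact: FX|move/disjoints_subset : FG; exact].
  have [D [defD FD DV]] := interp F V clF oV FV.
  have [||E [defE GE EV]] := interp G (X `\` closure V) clG.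
  + by apply: open_inDclosed; exact: closed_closure.
  + by move=> p Gp; split; [exact: GX|move=> /VG[]].
  exists D, E; split=> //.
  + by split=> // p /DV /(open_in_sub oV).
  + by split=> // p /EV[].
  + by apply/disjoints_subset => p /DV /subset_closure Vp /EV[].
- move=> sep F G clF clG FX GX FG.
  have [D [E [[defD DX] [defE EX] DE FD GE]]] := sep F G clF clG FX GX FG.
  exists D; split=> //; left; split=> //.
  by move: DE => /disjoints_subset DE; apply/disjoints_subset => p /DE nEp /GE.
- exact: (half_separation_network dT defX).
(* A supremum of distances below [e / 2] may equal [e / 2], which is still below [e]. *)
- move=> net p U e oU Up e0; have e20 : 0 < e / 2 by rewrite divr_gt0.
  have [V [oV Vp VU Vtame]] := network_tame_basis dT net e20 oU Up.
  exists V, (closure V); split=> //.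
    by split; [exact: closed_closure|exact: (closure_open_in defX oV)].
  apply: (@le_lt_trans _ _ (e / 2)%:E); last by rewrite lte_fin; lra.
  apply: hausdorff_dist_le; rewrite fatteningE //.
  by apply: (subset_trans (@subset_closure _ V)); exact: (sub_thicken dT).
- move=> haus.
  have approx : open_approximable (@type_dist R L M A n) X.
    move=> p U e oU Up e0; have [V [F [oV VU clF Vp VF]]] := haus p U e oU Up e0.
    exists V, F; split=> //; rewrite -fatteningE.
    exact: hausdorff_dist_lt.
  move=> p F Xp clF FX nFp.
  (* Interpolating from the closure of [V], not from [p] alone, places a relatively open set around
     [p] inside [D]. *)
  have [||V [oV pV VF]] := between [set p] (X `\` F) (@closed_point _ _ _ dT p).
  + exact: open_inDclosed.
  + by move=> _ ->.
  have interp := approximable_interpolation dT defX approx.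
  have [|||D [defD VD DF]] := interp (closure V) (X `\` F).
  + exact: closed_closure.
  + exact: open_inDclosed.
  + exact: VF.
  exists D; split=> //; first by move=> q /DF[].
    by exists V; split=> //; [exact: pV|exact: subset_trans (@subset_closure _ V) VD].
  by apply/disjoints_subset => q /DF[].
Qed.
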